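(* Let $N\geq 2$, let $\mathcal{P},\mathcal{M}$ be nonempty disjoint sets with $\mathcal{P}\cup\mathcal{M}=\{1,\dots,N\}$, and consider the polynomial system $$\dot x(t)=AZ(x(t))+Bu(t),\quad x(0)=0,\quad y_i(t)=C_iZ(x(t)),\quad i\in\{1,\dots,N\},$$ with state $x(t)\in\mathbb{R}^n$ and input $u(t)\in\mathbb{R}^m$, where $Z(x)$ is a vector of polynomial basis functions in $x$ and $A$, $B$, $C_i$ are real matrices of appropriate dimension. Let $Q_i=Q_i^\top\succeq0$ ($i\in\mathcal{P}$), $R_j=R_j^\top\succeq0$ and $\delta_j>0$ ($j\in\mathcal{M}$). Then the value of the optimization problem $$\sup_{u\in\mathcal{L}_{2e}}\ \frac1{|\mathcal{P}|}\sum_{i\in\mathcal{P}}\int_0^\infty y_i(t)^\top Q_iy_i(t)\,dt\quad\text{s.t.}\quad\int_0^\infty y_j(t)^\top R_jy_j(t)\,dt\le\delta_j\quad\forall j\in\mathcal{M}$$ is upper bounded by the value of the sum-of-squares program $$\min_{\bm\gamma,\,S}\ \sum_{j\in\mathcal{M}}\gamma_j\delta_j\quad\text{s.t.}\quad \bm\gamma\ge0,\quad Z(x)^\top\Gamma Z(x)-\frac{\partial S(x)}{\partial x}\big(AZ(x)+Bu\big)\ \text{ is SOS in }(x,u),$$ $$\Gamma=\sum_{j\in\mathcal{M}}\gamma_jC_j^\top R_jC_j-\frac1{|\mathcal{P}|}\sum_{i\in\mathcal{P}}C_i^\top Q_iC_i,$$ where $\bm\gamma=(\gamma_j)_{j\in\mathcal{M}}\in\mathbb{R}^{|\mathcal{M}|}$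 and $S(x)$ is an SOS polynomial in $x$.
   Context: $\mathcal{L}_{2e}$ is the set of signals $u:\mathbb{R}_+\to\mathbb{R}^m$ with $\int_0^{T}u(t)^\top u(t)\,dt<\infty$ for every $T\in\mathbb{R}_+$. A real polynomial is SOS (sum of squares) if it is a finite sum of squares of real polynomials in the indicated variables. $\partial S/\partial x$ is the row vector of partial derivatives of $S$. $\bm\gamma\ge0$ is elementwise. Conventions: the value of a minimization problem with empty feasible set is $+\infty$; integrals of nonnegative functions may take the value $+\infty$.
   Formalization: The sum-of-squares program here additionally requires S(0)=0; without this normalization of the storage function at x(0)=0 the claim is false (e.g. x1'=u, x2'=x1^2(1-x2), y1=x1(1-x2), Q1=2, y2=0, S=(1-x2)^2, gamma=0). *)

(* Defs.v *)
From HB Require Import structures.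
From mathcomp Require Import all_boot all_order all_algebra.
From mathcomp Require Import all_classical all_reals all_analysis.
(* Only the algebraic structures of mpoly are imported: its notations clash with
   those of mathcomp-analysis, hence the qualified names below. *)
From mathcomp Require Import (canonicals, coercions) mpoly.

Set Implicit Arguments.
Unset Strict Implicit.
Unset Printing Implicit Defensive.
Import Order.TTheory GRing.Theory Num.Theory numFieldNormedType.Exports.

Local Open Scope classical_set_scope.
Local Open Scope ring_scope.

Definition quad_form (R : pzRingType) (k : nat) (W : 'M[R]_k) (v : 'cV[R]_k) : R :=
  (v^T *m W *m v) 0 0.

Definition sym_psd (R : numDomainType) (k : nat) (W : 'M[R]_k) : Prop :=
  W^T = W /\ forall v : 'cV[R]_k, 0 <= quad_form W v.

(* Signals are total functions on the line; only their values on [0, +oo[ matter. *)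
Definition L2e (R : realType) (m : nat) (u : R -> 'cV[R]_m) : Prop :=
  (forall i, measurable_fun (`[0, +oo[ : set R) (fun t : R => u t i 0)) /\
  (forall T : R, 0 <= T ->
    (\int[lebesgue_measure]_(t in `[0%R, T]) (((u t)^T *m u t) 0 0)%:E < +oo)%E).

Definition evalZ (R : realType) (n q : nat) (Z : 'cV[mpoly.mpoly n R]_q)
    (x : 'cV[R]_n) : 'cV[R]_q :=
  map_mx (mpoly.meval (fun i => x i 0)) Z.

(* x is a Caratheodory solution on [0, +oo[ of x' = A Z(x) + B u, x(0) = 0:
   since u is only locally square integrable, x is locally absolutely continuous
   and satisfies the equation almost everywhere, i.e. the integral equation. *)
Definition is_trajectory (R : realType) (n m q : nat)
    (Z : 'cV[mpoly.mpoly n R]_q) (A : 'M[R]_(n, q)) (B : 'M[R]_(n, m))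
    (u : R -> 'cV[R]_m) (x : R -> 'cV[R]_n) : Prop :=
  forall (i : 'I_n) (t : R), 0 <= t ->
    let f := fun s : R => (A *m evalZ Z (x s) + B *m u s) i 0 in
    lebesgue_measure.-integrable `[0, t] (EFin \o f) /\
    x t i 0 = Rintegral lebesgue_measure `[0, t] f.

(* The integral of y^T W y over [0, +oo[, possibly +oo. *)
Definition weighted_energy (R : realType) (k : nat) (W : 'M[R]_k)
    (y : R -> 'cV[R]_k) : \bar R :=
  (\int[lebesgue_measure]_(t in `[0%R, +oo[) (quad_form W (y t))%:E)%E.

(* The supremum runs over the inputs whose trajectory exists on all of [0, +oo[,
   the only ones for which the integrals make sense; the vector field being
   polynomial in x, that trajectory is determined by u on [0, +oo[. *)
Definition energy_value (R : realType) (N n m q : nat) (r : 'I_N -> nat)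
    (P M : {set 'I_N}) (Z : 'cV[mpoly.mpoly n R]_q)
    (A : 'M[R]_(n, q)) (B : 'M[R]_(n, m)) (C : forall i, 'M[R]_(r i, q))
    (Q Rw : forall i, 'M[R]_(r i)) (delta : 'I_N -> R) : \bar R :=
  ereal_sup [set J : \bar R | exists u : R -> 'cV[R]_m, exists x : R -> 'cV[R]_n,
    let y := fun (i : 'I_N) (t : R) => C i *m evalZ Z (x t) in
    [/\ L2e u,
        is_trajectory Z A B u x,
        (forall j, j \in M -> (weighted_energy (Rw j) (y j) <= (delta j)%:E)%E) &
        J = ((#|P|%:R^-1)%:E * \sum_(i in P) weighted_energy (Q i) (y i))%E]].

Definition is_sos (R : realType) (k : nat) (p : mpoly.mpoly k R) : Prop :=
  exists s : seq (mpoly.mpoly k R), p = \sum_(g <- s) g ^+ 2.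

(* Polynomials in (x, u) are polynomials in n + m variables: the first n are the
   components of x, the last m those of u. *)
Definition in_xu (R : realType) (n m : nat) (p : mpoly.mpoly n R) :
    mpoly.mpoly (n + m) R :=
  mpoly.comp_mpoly [tuple mpoly.mpolyX R (mpoly.mnm1 (lshift m i)) | i < n] p.

Definition u_var (R : realType) (n m : nat) : 'cV[mpoly.mpoly (n + m) R]_m :=
  \col_j mpoly.mpolyX R (mpoly.mnm1 (rshift n j)).

Definition const_poly_mx (R : realType) (k a b : nat) (W : 'M[R]_(a, b)) :
    'M[mpoly.mpoly k R]_(a, b) :=
  map_mx (@mpoly.mpolyC k R) W.

Definition gradient (R : realType) (n : nat) (S : mpoly.mpoly n R) :
    'rV[mpoly.mpoly n R]_n :=
  \row_i mpoly.mderiv i S.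

Definition Gamma (R : realType) (N q : nat) (r : 'I_N -> nat) (P M : {set 'I_N})
    (C : forall i, 'M[R]_(r i, q)) (Q Rw : forall i, 'M[R]_(r i))
    (gamma : 'I_N -> R) : 'M[R]_q :=
  \sum_(j in M) gamma j *: ((C j)^T *m Rw j *m C j)
  - #|P|%:R^-1 *: \sum_(i in P) (C i)^T *m Q i *m C i.

(* Z^T Gamma Z - dS/dx (A Z + B u), as a polynomial in (x, u). *)
Definition dissipation_poly (R : realType) (n m q : nat)
    (Z : 'cV[mpoly.mpoly n R]_q) (A : 'M[R]_(n, q)) (B : 'M[R]_(n, m))
    (G : 'M[R]_q) (S : mpoly.mpoly n R) : mpoly.mpoly (n + m) R :=
  let Zxu := map_mx (@in_xu R n m) Z in
  quad_form (const_poly_mx (n + m) G) Zxu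
  - (map_mx (@in_xu R n m) (gradient S) *m
       (const_poly_mx (n + m) A *m Zxu
        + const_poly_mx (n + m) B *m u_var R n m)) 0 0.

(* Multipliers and storage functions of the program. Only the values of gamma on
   M are used. The storage function is normalized by S(0) = 0 at the initial
   state: for an arbitrary sum of squares S the dissipation inequality only
   bounds the energy by \sum_(j in M) gamma j * delta j + S(0). For instance,
   with x1' = u, x2' = x1^2 (1 - x2), output x1 (1 - x2) of weight 2 to be
   maximized and a zero constrained output, S = (1 - x2)^2 and gamma = 0 satisfy
   the other constraints, with objective 0, although the energy can be positive. *)
Definition sos_feasible (R : realType) (N n m q : nat) (r : 'I_N -> nat)
    (P M : {set 'I_N}) (Z : 'cV[mpoly.mpoly n R]_q)
    (A : 'M[R]_(n, q)) (B : 'M[R]_(n, m)) (C : forall i, 'M[R]_(r i, q))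
    (Q Rw : forall i, 'M[R]_(r i)) (gamma : 'I_N -> R) (S : mpoly.mpoly n R) : Prop :=
  [/\ forall j, j \in M -> 0 <= gamma j,
      is_sos S,
      mpoly.meval (fun _ => 0) S = 0 &
      is_sos (dissipation_poly Z A B (Gamma P M C Q Rw gamma) S)].

(* The infimum of the empty set is +oo. *)
Definition sos_value (R : realType) (N n m q : nat) (r : 'I_N -> nat)
    (P M : {set 'I_N}) (Z : 'cV[mpoly.mpoly n R]_q)
    (A : 'M[R]_(n, q)) (B : 'M[R]_(n, m)) (C : forall i, 'M[R]_(r i, q))
    (Q Rw : forall i, 'M[R]_(r i)) (delta : 'I_N -> R) : \bar R :=
  ereal_inf [set v : \bar R | exists gamma : 'I_N -> R, exists S : mpoly.mpoly n R,
    sos_feasible P M Z A B C Q Rw gamma S /\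
    v = (\sum_(j in M) gamma j * delta j)%:E].

(* Main.v *)
Require Import Defs.
From HB Require Import structures.
From mathcomp Require Import all_boot all_order all_algebra.
From mathcomp Require Import all_classical all_reals all_analysis.
From mathcomp Require Import (canonicals, coercions) mpoly.
From mathcomp Require Import measurable_realfun ring.

(* Along a trajectory, S(x(t)) is an indefinite integral of dS/dx (A Z + B u), so
   integrating the pointwise nonnegativity of the dissipation polynomial over
   [0, T] gives 0 <= S(x(T)) - S(0) <= int_0^T Z^T Gamma Z. This bounds the mean
   energy of the outputs in P over [0, T] by the sum of gamma j * delta j, and T
   goes to infinity.
   The state is merely absolutely continuous; the chain rule for polynomials
   reduces to the product rule for indefinite integrals, which is Fubini's theorem
   for f(s) g(r) on the two triangles of the square [0, T]^2. *)

Import Order.TTheory GRing.Theory Num.Theory numFieldNormedType.Exports.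

Local Open Scope ring_scope.

(** * Fubini's theorem for [f x * g y], split along a measurable set and its complement *)

Section Fubini_split.
Local Open Scope classical_set_scope.
Context d1 d2 (T1 : measurableType d1) (T2 : measurableType d2) (R : realType).
Variables (m1 : {sigma_finite_measure set T1 -> \bar R})
          (m2 : {sigma_finite_measure set T2 -> \bar R}).
Variables (f : T1 -> R) (g : T2 -> R) (D : set (T1 * T2)).
Hypotheses (intf : m1.-integrable setT (EFin \o f))
           (intg : m2.-integrable setT (EFin \o g)) (mD : measurable D).

Let h (p : T1 * T2) : \bar R := (f p.1 * g p.2)%:E.

Let mf : measurable_fun setT f.
Proof. exact/measurable_EFinP/(measurable_int m1). Qed.

Let mg : measurable_fun setT g.
Proof. exact/measurable_EFinP/(measurable_int m2). Qed.

Let mh : measurable_fun setT h.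
Proof.
apply/measurable_EFinP; apply: measurable_funM.
- exact: (measurableT_comp mf measurable_fst).
- exact: (measurableT_comp mg measurable_snd).
Qed.

(** Tonelli: the iterated integral of [|f x| * |g y|] factors into the product of the two norms,
    both finite. *)
Let inth : (m1 \x m2)%E.-integrable setT h.
Proof.
apply/integrable12ltyP => //.
have [/integrableP[_ fltoo] /integrableP[_ gltoo]] := (intf, intg).
have gE : (\int[m2]_y `|(g y)%:E| \is a fin_num)%E.
  by rewrite ge0_fin_numE//; exact: integral_ge0.
rewrite (_ : (\int[m1]_x _ =
    \int[m1]_x `|(f x)%:E| * \int[m2]_y `|(g y)%:E|)%E); last first.
  rewrite -(fineK gE) -ge0_integralZr//; last 2 first.
  - by apply: measurableT_comp => //; exact/measurable_EFinP.
  - by rewrite fineK//; exact: integral_ge0.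
  apply: eq_integral => x _; rewrite (fineK gE) -ge0_integralZl//; last first.
    by apply: measurableT_comp => //; exact/measurable_EFinP.
  by apply: eq_integral => y _; rewrite /h EFinM abseM.
apply: lte_mul_pinfty => //; first exact: integral_ge0.
by rewrite ge0_fin_numE//; exact: integral_ge0.
Qed.

Let inthS E : measurable E -> (m1 \x m2)%E.-integrable setT (h \_ E).
Proof.
move=> mE; apply: (integrable_mkcond h mE).1.
exact: integrableS inth.
Qed.

(** Bridge between the two kinds of integral: Fubini speaks of extended-real integrals of restricted
    functions, the product rule of real ones. The constant [c] stands for the factor whose variable
    is frozen. *)
Let sectionE d (T : measurableType d) (m : {measure set T -> \bar R})
    (k : T -> R) (c : R) (E : set T) :
  measurable E -> m.-integrable setT (EFin \o k) ->
  (\int[m]_t ((fun t => (c * k t)%:E) \_ E) t =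
   (c * \int[m]_(t in E) k t)%:E)%E.
Proof.
move=> mE ik; have ikE : m.-integrable E (EFin \o k) by exact: integrableS ik.
rewrite -integral_mkcond -RintegralZl// fineK//.
by apply: integrable_fin_num => //; exact: integrableZl ikE.
Qed.

Let FE x : (\int[m2]_y (h \_ D) (x, y) =
  (f x * \int[m2]_(y in xsection D x) g y)%:E)%E.
Proof.
rewrite -sectionE//; last exact: measurable_xsection.
by apply: eq_integral => y _; rewrite !patchE mem_xsection.
Qed.

Let GE y : (\int[m1]_x (h \_ (~` D)) (x, y) =
  (g y * \int[m1]_(x in ysection (~` D) y) f x)%:E)%E.
Proof.
rewrite -sectionE//; last exact/measurable_ysection/measurableC.
by apply: eq_integral => x _; rewrite !patchE mem_ysection /h /= mulrC.
Qed.

Lemma integrable_mul_xsection :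
  m1.-integrable setT
    (EFin \o (fun x => f x * \int[m2]_(y in xsection D x) g y)).
Proof.
have := integrable_fubini_F (inthS D mD).
by apply: eq_integrable => // x _; rewrite /fubini_F FE.
Qed.

(** The two terms on the left are iterated integrals of [f x * g y], over [D] with y innermost and
    over its complement with x innermost. They add up to the integral over the whole product space,
    which factors. *)
Lemma Rintegral_mul_sections :
  \int[m1]_x (f x * \int[m2]_(y in xsection D x) g y) +
  \int[m2]_y (g y * \int[m1]_(x in ysection (~` D) y) f x) =
  (\int[m1]_x f x) * (\int[m2]_y g y).
Proof.
have mDC := measurableC mD.
have E1 : (\int[m1]_x (f x * \int[m2]_(y in xsection D x) g y)%:E =
    \int[m1 \x m2]_(z in D) h z)%E.
  rewrite [RHS]integral_mkcond -integral12_prod_meas1; last exact: inthS.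
  by apply: eq_integral => x _; rewrite -FE.
have E2 : (\int[m2]_y (g y * \int[m1]_(x in ysection (~` D) y) f x)%:E =
    \int[m1 \x m2]_(z in ~` D) h z)%E.
  rewrite [RHS]integral_mkcond -integral21_prod_meas1; last exact: inthS.
  by apply: eq_integral => y _; rewrite -GE.
have E3 : (\int[m1 \x m2]_z h z = ((\int[m1]_x f x) * (\int[m2]_y g y))%R%:E)%E.
  rewrite -integral12_prod_meas1//.
  (* [sectionE] with the whole space as section, read backwards twice: first the integral of [g] is
     the constant, then the value [f x]. *)
  rewrite mulrC -sectionE// patch_setT.
  apply: eq_integral => x _; rewrite -[RHS]/(_%:E) mulrC -sectionE//.
  by rewrite patch_setT.
rewrite [X in X + _]/Rintegral [X in _ + X]/Rintegral E1 E2.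
have ihE E : measurable E -> (m1 \x m2)%E.-integrable E h.
  by move=> mE; exact: integrableS inth.
rewrite -fineD; [|exact: integrable_fin_num (ihE _ _)..].
rewrite -integral_setU//; last 2 first.
- by rewrite setUv.
- by apply/disj_setPS; rewrite setICr.
by rewrite setUv E3.
Qed.

End Fubini_split.

(** * Product of two indefinite integrals *)

Section product_rule.
Local Open Scope classical_set_scope.
Context {R : realType}.
Notation mu := (@lebesgue_measure R).
Implicit Types (f g : R -> R) (T t : R).

(** Inside the square this half-plane and its complement are the two triangles. The diagonal belongs
    to [below], so the sections of the complement are open rays. *)
Let below : set (R * R) := [set p | p.2 <= p.1].

Let measurable_below : measurable below.
Proof.
rewrite (_ : below = (fun p => p.1 - p.2) @^-1` `[0, +oo[).
  rewrite -[X in measurable X]setTI.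
  by apply: (measurable_funB measurable_fst measurable_snd).
by apply/seteqP; split => p /=; rewrite in_itv/= andbT subr_ge0.
Qed.

Let xsection_below t : xsection below t = `]-oo, t]%classic.
Proof.
by apply/seteqP; split => s /=; rewrite /xsection/= inE /below/= in_itv.
Qed.

Let ysection_below t : ysection (~` below) t = `]-oo, t[%classic.
Proof.
apply/seteqP; split => s /=; rewrite /ysection/= inE /below/= in_itv/= ltNge;
  by move/negP.
Qed.

(** Extension by zero outside [0, T] turns integrals over the square into integrals over the plane;
    a ray ending at t then meets the support in [0, t]. *)
Let tail_interval f T t : 0 <= t <= T ->
  \int[mu]_(s in `]-oo, t]) (f \_ `[0, T]) s = \int[mu]_(s in `[0, t]) f s.
Proof.
move=> /andP[t0 tT]; rewrite -Rintegral_mkcondr; congr Rintegral.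
apply/seteqP; split => s /=; rewrite !in_itv/=.
  by move=> [st /andP[s0 _]]; rewrite s0.
by move=> /andP[s0 st]; rewrite s0 st (le_trans st tT).
Qed.

(** The open ray misses only the endpoint t, a null set. *)
Let tail_intervalo f T t :
  0 <= t <= T -> mu.-integrable `[0, T] (EFin \o f) ->
  \int[mu]_(s in `]-oo, t[) (f \_ `[0, T]) s = \int[mu]_(s in `[0, t]) f s.
Proof.
move=> /andP[t0 tT] intf.
rewrite -Rintegral_itv_bndo_bndc; last first.
  apply: integrableS intf => //; apply: subset_itvl.
  by rewrite bnd_simp.
rewrite -Rintegral_mkcondr; congr Rintegral.
apply/seteqP; split => s /=; rewrite !in_itv/=.
  by move=> [st /andP[s0 _]]; rewrite s0.
by move=> /andP[s0 st]; rewrite s0 st (ltW (lt_le_trans st tT)).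
Qed.

Let integrable_restrict0 f T : mu.-integrable `[0, T] (EFin \o f) ->
  mu.-integrable setT (EFin \o (f \_ `[0, T])).
Proof.
by move=> intf; rewrite -restrict_EFin; apply: (integrable_mkcond _ _).1.
Qed.

(** This function is the inner integral of [f s * g r] over the triangle r <= s, hence integrable by
    Fubini. *)
Lemma integrable_mul_primitive f g T :
  mu.-integrable `[0, T] (EFin \o f) -> mu.-integrable `[0, T] (EFin \o g) ->
  mu.-integrable `[0, T] (EFin \o (fun s => f s * \int[mu]_(r in `[0, s]) g r)).
Proof.
move=> intf intg.
have H := integrable_mul_xsection _ _ _ _ _ mu mu _ _ below
  (integrable_restrict0 _ _ intf) (integrable_restrict0 _ _ intg)
  measurable_below.
refine (eq_integrable _ _ _ _ (integrableS _ _ _ H)) => //.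
move=> s; rewrite inE => sT /=.
by rewrite xsection_below tail_interval// patchE mem_set.
Qed.

Lemma primitive_mul f g T : 0 <= T ->
  mu.-integrable `[0, T] (EFin \o f) -> mu.-integrable `[0, T] (EFin \o g) ->
  (\int[mu]_(s in `[0, T]) f s) * (\int[mu]_(s in `[0, T]) g s) =
  \int[mu]_(s in `[0, T]) (f s * \int[mu]_(r in `[0, s]) g r) +
  \int[mu]_(s in `[0, T]) (g s * \int[mu]_(r in `[0, s]) f r).
Proof.
move=> T0 intf intg.
have H := Rintegral_mul_sections _ _ _ _ _ mu mu _ _ below
  (integrable_restrict0 _ _ intf) (integrable_restrict0 _ _ intg)
  measurable_below.
rewrite [X in X * _ = _]Rintegral_mkcond [X in _ * X = _]Rintegral_mkcond -{}H.
apply: f_equal2.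
  rewrite [RHS]Rintegral_mkcond; apply: eq_Rintegral => s _.
  rewrite !patchE; case: ifPn => [|_]; last by rewrite mul0r.
  by rewrite inE => sT; rewrite xsection_below tail_interval.
rewrite [RHS]Rintegral_mkcond; apply: eq_Rintegral => s _.
rewrite !patchE; case: ifPn => [|_]; last by rewrite mul0r.
by rewrite inE => sT; rewrite ysection_below tail_intervalo.
Qed.

End product_rule.

(** * Calculus of indefinite integrals, up to the chain rule for polynomials *)

Section primitive.
Local Open Scope classical_set_scope.
Context {R : realType}.
Notation mu := (@lebesgue_measure R).
Implicit Types (F G f g : R -> R) (T t c : R).

(** Local absolute continuity on [0, +oo[ with derivative [f] almost everywhere, in integral form,
    which sums and products preserve. Integrability is recorded because a real-valued integral falls
    back to a default value when it is infinite. *)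
Definition is_primitive F f := forall T, 0 <= T ->
  mu.-integrable `[0, T] (EFin \o f) /\ F T = F 0 + \int[mu]_(s in `[0, T]) f s.

Lemma integrable_itvcc_cst T c : mu.-integrable `[0, T] (EFin \o cst c).
Proof.
apply: measurable_bounded_integrable => //.
  by rewrite /= lebesgue_measure_itv/=; case: ifP => _; rewrite ?ltry.
by exists `|c|; split => [|y /ltW cy s _] //; exact: num_real.
Qed.

Lemma is_primitive_cst c : is_primitive (cst c) (cst 0).
Proof.
move=> T T0; split; first exact: integrable_itvcc_cst.
by rewrite Rintegral_cst// mul0r addr0.
Qed.

Lemma is_primitiveD F G f g : is_primitive F f -> is_primitive G g ->
  is_primitive (fun t => F t + G t) (fun t => f t + g t).
Proof.
move=> Ff Gg T T0; have [[intf ->] [intg ->]] := (Ff T T0, Gg T T0).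
by split; [exact: (integrableD _ intf intg)|rewrite RintegralD// addrACA].
Qed.

(** Substituting G s = G 0 + (integral of [g] over [0, s]) splits [f s * G s] into a multiple of [f]
    and the function of [integrable_mul_primitive]. *)
Let integrable_mulr f G g T : 0 <= T -> mu.-integrable `[0, T] (EFin \o f) ->
  is_primitive G g -> mu.-integrable `[0, T] (EFin \o (fun s => f s * G s)) /\
  \int[mu]_(s in `[0, T]) (f s * G s) =
  \int[mu]_(s in `[0, T]) f s * G 0 +
  \int[mu]_(s in `[0, T]) (f s * \int[mu]_(r in `[0, s]) g r).
Proof.
move=> T0 intf Gg; have [intg _] := Gg T T0.
have intfg := integrable_mul_primitive f g T intf intg.
have intfc : mu.-integrable `[0, T] (EFin \o (fun s => f s * G 0)).
  exact: (integrableZr _ (G 0) intf).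
have E : {in `[0, T]%classic, forall s,
    f s * G 0 + f s * (\int[mu]_(r in `[0, s]) g r) = f s * G s}.
  by move=> s; rewrite inE/= in_itv/= => /andP[/Gg[_ ->] _]; rewrite mulrDr.
split.
  by apply: eq_integrable (integrableD _ intfc intfg) => // s /E /= <-.
rewrite -RintegralZr// -RintegralD//.
by apply: eq_Rintegral => s /E.
Qed.

Lemma integrable_primitive F f T : 0 <= T -> is_primitive F f ->
  mu.-integrable `[0, T] (EFin \o F).
Proof.
(* The case of the constant factor 1 in [integrable_mulr]. *)
move=> T0 Ff; have [+ _] :=
  integrable_mulr _ _ _ _ T0 (integrable_itvcc_cst T 1) Ff.
by apply: eq_integrable => // s _ /=; rewrite mul1r.
Qed.

Lemma is_primitiveM F G f g : is_primitive F f -> is_primitive G g ->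
  is_primitive (fun t => F t * G t) (fun t => f t * G t + F t * g t).
Proof.
move=> Ff Gg T T0; have [[intf FT] [intg GT]] := (Ff T T0, Gg T T0).
have [intfG fGE] := integrable_mulr _ _ _ _ T0 intf Gg.
have [intgF gFE] := integrable_mulr _ _ _ _ T0 intg Ff.
have intFg : mu.-integrable `[0, T] (EFin \o (fun s => F s * g s)).
  by apply: eq_integrable intgF => // s _ /=; rewrite mulrC.
split; first exact: (integrableD _ intfG intFg).
rewrite RintegralD// fGE.
under [X in _ + (_ + X)]eq_Rintegral do rewrite mulrC.
(* Once both factors are expanded around their values at 0, the only nonlinear term is the product
   of the two integrals, which [primitive_mul] turns into the two iterated ones. *)
rewrite gFE FT GT mulrDl !mulrDr primitive_mul//; ring.
Qed.

Lemma eq_is_primitive F G f g : F =1 G -> f =1 g ->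
  is_primitive F f -> is_primitive G g.
Proof. by move=> /funext -> /funext ->. Qed.

(** Chain rule: the polynomials that satisfy it include constants and variables and are stable under
    sums and products, by linearity and the Leibniz rule for [mderiv]; so they are all
    polynomials. *)
Lemma is_primitive_meval n (p : mpoly.mpoly n R) (x v : R -> 'I_n -> R) :
  (forall i, is_primitive (fun t => x t i) (fun t => v t i)) ->
  is_primitive (fun t => mpoly.meval (x t) p)
    (fun t => \sum_i mpoly.meval (x t) (mpoly.mderiv i p) * v t i).
Proof.
move=> xv.
pose P q := is_primitive (fun t => mpoly.meval (x t) q)
    (fun t => \sum_i mpoly.meval (x t) (mpoly.mderiv i q) * v t i).
have PC c : P (mpoly.mpolyC n c).
  apply: eq_is_primitive (is_primitive_cst c) => t.
    by rewrite mpoly.mevalC.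
  by rewrite big1// => i _; rewrite mpoly.mderivC mpoly.meval0 mul0r.
have PX i : P (mpoly.mpolyX R (mpoly.mnm1 i)).
  apply: eq_is_primitive (xv i) => t; first by rewrite mpoly.mevalXU.
  rewrite (bigD1 i)//= big1 => [|j ji]; rewrite mpoly.mderivX mpoly.mnm1E.
    (* Differentiating the variable in its own direction leaves the monomial of exponent
       [mnm1 i - mnm1 i]; writing the first as [0 + mnm1 i] makes it cancel to the constant 1. *)
    rewrite eqxx scale1r -{1}[mpoly.mnm1 i]mpoly.add0m mpoly.addmK.
    by rewrite mpoly.mpolyX0 mpoly.meval1 mul1r addr0.
  by rewrite eq_sym (negbTE ji) scale0r mpoly.meval0 mul0r.
have PD q1 q2 : P q1 -> P q2 -> P (q1 + q2).
  move=> P1 P2; apply: eq_is_primitive (is_primitiveD _ _ _ _ P1 P2) => t.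
    by rewrite mpoly.mevalD.
  rewrite -big_split; apply: eq_bigr => i _.
  by rewrite mpoly.mderivD mpoly.mevalD mulrDl.
have PM q1 q2 : P q1 -> P q2 -> P (q1 * q2).
  move=> P1 P2; apply: eq_is_primitive (is_primitiveM _ _ _ _ P1 P2) => t.
    by rewrite mpoly.mevalM.
  rewrite mulr_suml mulr_sumr -big_split; apply: eq_bigr => i _.
  by rewrite mpoly.mderivM mpoly.mevalD !mpoly.mevalM mulrDl mulrAC mulrA.
suff : P p by [].
elim/mpoly.mpolyind : p => [|c m p _ _ Pp].
  by have := PC 0; rewrite mpoly.mpolyC0.
(* A term is a constant times a monomial, and a monomial is a product of powers of variables, so
   [PC], [PX] and [PM] suffice. *)
apply: PD Pp; rewrite -mpoly.mul_mpolyC; apply: (PM _ _ (PC c)).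
rewrite mpoly.mpolyXE_id; elim/big_ind : _ => [|//|i _].
  by have := PC 1; rewrite mpoly.mpolyC1.
elim: (m i) => [|k IH]; last by rewrite exprS; exact: PM.
by have := PC 1; rewrite mpoly.mpolyC1 expr0.
Qed.

End primitive.

(** * Passage from bounded intervals to the half-line *)

Section half_line.
Local Open Scope classical_set_scope.
Context {R : realType}.
Notation mu := (@lebesgue_measure R).
Implicit Types (e : R -> R) (T V : R).

Lemma measurable_itv0y e :
  (forall T, 0 <= T -> mu.-integrable `[0, T] (EFin \o e)) ->
  measurable_fun (`[0, +oo[ : set R) (EFin \o e).
Proof.
move=> inte; rewrite itv0y_bigcup0S; apply/measurable_fun_bigcup => // k.
exact: measurable_int (inte _ _).
Qed.

(** Monotone convergence along the intervals [0, k + 1], whose union is the half-line. *)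
Lemma integral_itv0y_le e V :
  (forall t, 0 <= t -> 0 <= e t) ->
  (forall T, 0 <= T -> mu.-integrable `[0, T] (EFin \o e)) ->
  (forall T, 0 <= T -> \int[mu]_(s in `[0, T]) e s <= V) ->
  (\int[mu]_(t in `[0%R, +oo[) (e t)%:E <= V%:E)%E.
Proof.
move=> e0 inte leV.
have cvgI : (\int[mu]_(t in `[0%R, k.+1%:R]) (e t)%:E @[k --> \oo] -->
    \int[mu]_(t in `[0%R, +oo[) (e t)%:E)%E.
  rewrite itv0y_bigcup0S; apply: ge0_nondecreasing_set_cvg_integral.
  - move=> k l kl; rewrite subsetEset; apply: subset_itvl.
    by rewrite bnd_simp ler_nat.
  - by [].
  - by move=> k; exact: measurable_int (inte _ _).
  - by move=> k t /=; rewrite in_itv/= => /andP[t0 _]; rewrite lee_fin e0.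
rewrite -(cvg_lim _ cvgI)//; apply: lime_le; first exact: cvgP cvgI.
apply: nearW => k; have k0 : 0 <= k.+1%:R :> R by [].
rewrite -[leLHS]fineK ?lee_fin; first exact: leV.
exact: integrable_fin_num (inte _ _).
Qed.

Lemma Rintegral_le_itv0y e T : 0 <= T ->
  (forall t, 0 <= t -> 0 <= e t) ->
  (forall T, 0 <= T -> mu.-integrable `[0, T] (EFin \o e)) ->
  ((\int[mu]_(s in `[0, T]) e s)%:E <= \int[mu]_(t in `[0%R, +oo[) (e t)%:E)%E.
Proof.
move=> T0 e0 inte; rewrite fineK; last exact: integrable_fin_num (inte _ _).
apply: ge0_subset_integral => //.
- exact: measurable_itv0y.
- by move=> t /=; rewrite in_itv/= andbT lee_fin => /e0.
- exact: subset_itvl.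
Qed.

End half_line.

(** Signs and measurability are given only for the indices in [P], just as the weights are
    semidefinite only on their own index set. The other summands are replaced by zero, so that every
    index qualifies. *)
Lemma ge0_integral_sum_cond d (T : measurableType d) (R : realType)
    (mu : {measure set T -> \bar R}) (D : set T) (I : Type) (s : seq I)
    (P : pred I) (f : I -> T -> \bar R) :
  measurable D -> (forall i, P i -> measurable_fun D (f i)) ->
  (forall i x, P i -> D x -> (0 <= f i x)%E) ->
  (\int[mu]_(x in D) \sum_(i <- s | P i) f i x =
   \sum_(i <- s | P i) \int[mu]_(x in D) f i x)%E.
Proof.
move=> mD mf f0.
pose g i x : \bar R := if P i then f i x else 0%E.
transitivity (\int[mu]_(x in D) \sum_(i <- s) g i x)%E.
  by apply: eq_integral => x _; exact: big_mkcond.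
rewrite (@ge0_integral_sum _ _ _ mu D mD _ g).
- apply: etrans (esym (big_mkcond _ _)); apply: eq_bigr => i _; rewrite /g.
  by case: ifP => // _; rewrite integral0.
- by move=> i; rewrite /g; case: (boolP (P i)) => // Pi; exact: mf.
- by move=> i x Dx; rewrite /g; case: ifPn => // /f0; apply.
Qed.

(** * Evaluation of the polynomial data at a state and an input *)

Section evaluation.
Context {R : realType}.

Lemma meval_mx k (w : 'I_k -> R) p q (X : 'M[mpoly.mpoly k R]_(p, q)) i j :
  mpoly.meval w (X i j) = map_mx (mpoly.meval w) X i j.
Proof. by rewrite mxE. Qed.

Lemma meval_const_mx k (w : 'I_k -> R) p q (W : 'M[R]_(p, q)) :
  map_mx (mpoly.meval w) (const_poly_mx k W) = W.
Proof. by apply/matrixP => i j; rewrite !mxE mpoly.mevalC. Qed.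

Lemma meval_quad_form k (w : 'I_k -> R) q (W : 'M[R]_q)
    (z : 'cV[mpoly.mpoly k R]_q) :
  mpoly.meval w (quad_form (const_poly_mx k W) z) =
  quad_form W (map_mx (mpoly.meval w) z).
Proof.
by rewrite /quad_form meval_mx !map_mxM map_trmx meval_const_mx.
Qed.

Lemma meval_sos_ge0 k (p : mpoly.mpoly k R) (w : 'I_k -> R) :
  is_sos p -> 0 <= mpoly.meval w p.
Proof.
move=> [s ->]; rewrite rmorph_sum/=; apply: sumr_ge0 => g _.
by rewrite rmorphXn/= sqr_ge0.
Qed.

Lemma meval_in_xu n m (x : 'cV[R]_n) (u : 'cV[R]_m) (p : mpoly.mpoly n R) :
  mpoly.meval (fun k => col_mx x u k 0) (in_xu m p) =
  mpoly.meval (fun i => x i 0) p.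
Proof.
rewrite /in_xu mpoly.comp_mpoly_meval; apply: mpoly.meval_eq => i.
by rewrite tnth_mktuple mpoly.mevalXU col_mxEu.
Qed.

(** Evaluation is a ring morphism, so it passes through the matrix products; at the stacked point
    [col_mx x u] the first variables give x and the last ones u. *)
Lemma meval_dissipation_poly n m q (Z : 'cV[mpoly.mpoly n R]_q)
    (A : 'M[R]_(n, q)) (B : 'M[R]_(n, m)) (G : 'M[R]_q) (S : mpoly.mpoly n R)
    (x : 'cV[R]_n) (u : 'cV[R]_m) :
  mpoly.meval (fun k => col_mx x u k 0) (dissipation_poly Z A B G S) =
  quad_form G (evalZ Z x) -
  \sum_i mpoly.meval (fun i => x i 0) (mpoly.mderiv i S) *
    (A *m evalZ Z x + B *m u) i 0.
Proof.
set w := fun k => _.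
have in_xuE p r (X : 'M[mpoly.mpoly n R]_(p, r)) :
    map_mx (mpoly.meval w) (map_mx (in_xu m) X) =
    map_mx (mpoly.meval (fun i => x i 0)) X.
  by apply/matrixP => i j; rewrite !mxE meval_in_xu.
have uE : map_mx (mpoly.meval w) (u_var R n m) = u.
  by apply/matrixP => i j; rewrite !mxE mpoly.mevalXU /w col_mxEd ord1.
rewrite /dissipation_poly rmorphB/= meval_quad_form in_xuE; congr (_ - _).
rewrite meval_mx map_mxM map_mxD !map_mxM !meval_const_mx !in_xuE uE.
by rewrite mxE; apply: eq_bigr => i _; rewrite !mxE.
Qed.

End evaluation.

Lemma quad_form_mulmx (R : comPzRingType) k q (W : 'M[R]_k) (C : 'M[R]_(k, q))
    (z : 'cV[R]_q) :
  quad_form W (C *m z) = quad_form (C^T *m W *m C) z.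
Proof. by rewrite /quad_form trmx_mul !mulmxA. Qed.

(** Linearity of [quad_form] in its matrix. The result reads the supply rate as the
    multiplier-weighted constrained densities minus the mean density of the objective. *)
Lemma quad_form_Gamma (R : realType) N q (r : 'I_N -> nat) (P M : {set 'I_N})
    (C : forall i, 'M[R]_(r i, q)) (Q Rw : forall i, 'M[R]_(r i))
    (gamma : 'I_N -> R) (z : 'cV[R]_q) :
  quad_form (Gamma P M C Q Rw gamma) z =
  \sum_(j in M) gamma j * quad_form (Rw j) (C j *m z) -
  #|P|%:R^-1 * \sum_(i in P) quad_form (Q i) (C i *m z).
Proof.
have lin (X Y : 'M[R]_q) : quad_form (X - Y) z = quad_form X z - quad_form Y z.
  by rewrite /quad_form mulmxBr mulmxBl !mxE.
have scal a (X : 'M[R]_q) : quad_form (a *: X) z = a * quad_form X z.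
  by rewrite /quad_form -scalemxAr -scalemxAl mxE.
have sum (A : {set 'I_N}) (X : 'I_N -> 'M[R]_q) :
    quad_form (\sum_(i in A) X i) z = \sum_(i in A) quad_form (X i) z.
  by rewrite /quad_form mulmx_sumr mulmx_suml summxE.
rewrite /Gamma lin scal !sum; congr (_ - _ * _).
- by apply: eq_bigr => j _; rewrite scal quad_form_mulmx.
- by apply: eq_bigr => i _; rewrite quad_form_mulmx.
Qed.

(** * Dissipation inequality along a trajectory *)

Section dissipation.
Local Open Scope classical_set_scope.
Context (R : realType) (n m q : nat) (Z : 'cV[mpoly.mpoly n R]_q)
  (A : 'M[R]_(n, q)) (B : 'M[R]_(n, m)) (u : R -> 'cV[R]_m) (x : R -> 'cV[R]_n).
Notation mu := (@lebesgue_measure R).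
Hypothesis xP : is_trajectory Z A B u x.

(** The initial condition is contained in the integral equation: at t = 0 the integral runs over a
    single point. *)
Lemma trajectory0 : x 0 = 0.
Proof.
apply/matrixP => i j; rewrite ord1 mxE.
have [_ ->] := xP i 0 (lexx 0).
by rewrite set_itv1 Rintegral_set1.
Qed.

Lemma is_primitive_trajectory (p : mpoly.mpoly n R) :
  is_primitive (fun t => mpoly.meval (fun i => x t i 0) p)
    (fun t => \sum_i mpoly.meval (fun i => x t i 0) (mpoly.mderiv i p) *
       (A *m evalZ Z (x t) + B *m u t) i 0).
Proof.
apply: (is_primitive_meval _ _ (fun t i => x t i 0)) => i T T0.
by have [intf xT] := xP i T T0; split=> //; rewrite trajectory0 mxE add0r.
Qed.

(** The density is a polynomial in the state, hence itself an indefinite integral along the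
    trajectory, hence integrable on [0, T]. *)
Lemma integrable_quad_form k (W : 'M[R]_k) (C : 'M[R]_(k, q)) T : 0 <= T ->
  mu.-integrable `[0, T] (EFin \o (fun t => quad_form W (C *m evalZ Z (x t)))).
Proof.
move=> T0.
have := integrable_primitive _ _ _ T0
  (is_primitive_trajectory (quad_form (const_poly_mx n (C^T *m W *m C)) Z)).
by apply: eq_integrable => // t _ /=; rewrite meval_quad_form quad_form_mulmx.
Qed.

(** By the chain rule the left side is the integral of dS/dx (A Z + B u). Its integrand is at most
    the supply rate, because the sum of squares is nonnegative at (x(t), u(t)) for every t. *)
Lemma dissipation_inequality (G : 'M[R]_q) (S : mpoly.mpoly n R) T :
  is_sos (dissipation_poly Z A B G S) -> 0 <= T ->
  mpoly.meval (fun i => x T i 0) S - mpoly.meval (fun=> 0) S <=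
  \int[mu]_(t in `[0, T]) quad_form G (evalZ Z (x t)).
Proof.
move=> sosS T0; have [intS ->] := is_primitive_trajectory S T T0.
rewrite (mpoly.meval_eq (v2 := fun=> 0)); last first.
  by move=> i; rewrite trajectory0 mxE.
rewrite addrC addKr; apply: le_Rintegral => //.
  have := integrable_quad_form _ G 1%:M _ T0.
  by apply: eq_integrable => // t _ /=; rewrite mul1mx.
move=> t _; rewrite -subr_ge0 -meval_dissipation_poly.
exact: meval_sos_ge0.
Qed.

End dissipation.

(** * Comparison of the two optimal values *)

Theorem theorem19 (R : realType) (N n m q : nat) (r : 'I_N -> nat)
    (P M : {set 'I_N}) (Z : 'cV[mpoly.mpoly n R]_q)
    (A : 'M[R]_(n, q)) (B : 'M[R]_(n, m)) (C : forall i : 'I_N, 'M[R]_(r i, q))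
    (Q Rw : forall i : 'I_N, 'M[R]_(r i)) (delta : 'I_N -> R)
    (N_ge2 : (2 <= N)%N)
    (P_neq0 : P != finset.set0) (M_neq0 : M != finset.set0)
    (PM_disjoint : [disjoint P & M]) (PM_cover : P :|: M = [set: 'I_N]%SET)
    (Q_psd : forall i, i \in P -> sym_psd (Q i))
    (Rw_psd : forall j, j \in M -> sym_psd (Rw j))
    (delta_gt0 : forall j, j \in M -> 0 < delta j) :
  (energy_value P M Z A B C Q Rw delta <= sos_value P M Z A B C Q Rw delta)%E.
Proof.
(* A supremum is compared with an infimum: it suffices to bound the objective of one admissible
   trajectory by that of one feasible pair. *)
apply: ge_ereal_sup => _ [u [x [_ xP leM ->]]].
apply: le_ereal_inf_tmp => _ [gamma [S [[gamma0 sosS S0 sosD] ->]]].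
pose e k (W : 'M[R]_k) (C : 'M[R]_(k, q)) t := quad_form W (C *m evalZ Z (x t)).
have int_e k (W : 'M[R]_k) (C : 'M[R]_(k, q)) T (T0 : 0 <= T) :=
  integrable_quad_form _ _ _ _ _ _ _ _ _ xP _ W C T T0.
have eP0 i t : i \in P -> 0 <= e _ (Q i) (C i) t by move=> /Q_psd [_]; exact.
have eM0 j t : j \in M -> 0 <= e _ (Rw j) (C j) t by move=> /Rw_psd [_]; exact.
have cP0 : 0 <= #|P|%:R^-1 :> R by rewrite invr_ge0.
pose J t := #|P|%:R^-1 * \sum_(i in P) e _ (Q i) (C i) t.
(* The coefficients stay free: they are taken to be the multipliers, the constant 1/|P| and the
   constant 1. *)
have intsum (D : {set 'I_N}) (W : forall i, 'M[R]_(r i)) (c : 'I_N -> R) T :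
    0 <= T ->
    lebesgue_measure.-integrable `[0, T]
      (EFin \o (fun t => \sum_(i in D) c i * e _ (W i) (C i) t)).
  move=> T0; rewrite (_ : _ \o _ =
      fun t => (\sum_(i in D) (c i * e _ (W i) (C i) t)%:E)%E).
    apply: integrable_sum => // i _.
    exact: (integrableZl _ (c i) (int_e _ _ _ _ T0)).
  by apply/funext => t /=; rewrite sumEFin.
have intJ T : 0 <= T -> lebesgue_measure.-integrable `[0, T] (EFin \o J).
  move=> T0; have := intsum P Q (fun=> #|P|%:R^-1) T T0.
  by apply: eq_integrable => // t _ /=; rewrite -mulr_sumr.
(* The objective becomes the integral of the single nonnegative density [J], so that bounding it
   over every [0, T] is enough. *)
rewrite (_ : (_ * _)%E =
    (\int[lebesgue_measure]_(t in `[0%R, +oo[) (J t)%:E)%E); last first.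
  under [RHS]eq_integral do rewrite EFinM.
  rewrite ge0_integralZl//; last 2 first.
  - apply: measurable_itv0y => T T0; have := intsum P Q (fun=> 1) T T0.
    by apply: eq_integrable => // t _ /=; under eq_bigr do rewrite mul1r.
  - by move=> t _; rewrite lee_fin sumr_ge0// => i /eP0.
  under [in RHS]eq_integral do rewrite -sumEFin.
  rewrite ge0_integral_sum_cond//.
  - by move=> i _; apply: measurable_itv0y => T; exact: int_e.
  - by move=> i t iP _; rewrite lee_fin; exact: eP0.
apply: integral_itv0y_le => // [t _|T T0].
  by rewrite mulr_ge0// sumr_ge0// => i /eP0.
pose K t := \sum_(j in M) gamma j * e _ (Rw j) (C j) t.
have := dissipation_inequality _ _ _ _ _ _ _ _ _ xP _ S T sosD T0.
rewrite S0 subr0.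
under eq_Rintegral do rewrite quad_form_Gamma -/(K _) -/(J _).
rewrite RintegralB//; [|exact: intsum|exact: intJ].
(* With S(0) = 0 and S(x(T)) >= 0, the integral of [K - J] over [0, T] is nonnegative; it remains to
   bound that of [K]. *)
move=> /(le_trans (meval_sos_ge0 _ _ _ sosS)); rewrite subr_ge0.
move=> /le_trans; apply.
rewrite -lee_fin fineK; last exact: integrable_fin_num (intsum _ _ _ _ T0).
under eq_integral do rewrite -sumEFin.
have intge j : lebesgue_measure.-integrable `[0, T]
    (fun t => (gamma j * e _ (Rw j) (C j) t)%:E).
  exact: (integrableZl _ (gamma j) (int_e _ _ _ _ T0)).
rewrite integral_sum// -sumEFin; apply: lee_sum => j jM.
under eq_integral do rewrite EFinM.
rewrite integralZl//; last exact: int_e.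
rewrite EFinM lee_wpmul2l ?lee_fin ?gamma0//.
(* Cutting the nonnegative constrained density off at T only lowers its energy, which is at most
   [delta j] over the half-line. *)
apply: le_trans (leM j jM); rewrite -[leLHS]fineK; last first.
  exact: integrable_fin_num (int_e _ _ _ _ T0).
apply: Rintegral_le_itv0y => // [t _|t t0]; [exact: eM0|exact: int_e].
Qed.
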